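(* Let $d$ be a positive integer, let $x,y\in\mathbb{C}$ and $\gamma_1,\gamma>0$ satisfy $0<|x|<\gamma_1<\gamma<|y|$. Let $\kappa(x,y)=1/(x-y)^d$ and, for each positive integer $N$, let $\tilde\kappa(x,y)$ be its $N$-point proxy approximation with proxy surface the circle of radius $\gamma$ centered at $0$ (composite trapezoidal rule, as defined in the context). Let $\varepsilon(x,y)=\frac{\tilde\kappa(x,y)-\kappa(x,y)}{\kappa(x,y)}$. Then there exists a positive integer $N_1$ such that for any $N>N_1$, $$|\varepsilon(x,y)|\leq g\!\left(\Big|\frac{y}{\gamma}\Big|^N\right)+c\,g\!\left(\Big|\frac{\gamma}{x}\Big|^N\right),$$ where $c=1$ if $d=1$, and otherwise $$c=2+2\sum_{j=1}^{d-1}\frac{\bigl[(|y/x|+1)N\bigr]^j(2d)^{j-1}}{j!}.$$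
   Context: $g(z)=\frac{1}{z-1}$ for $z\neq 1$. The kernel is $\kappa(x,y)=\frac{1}{(x-y)^d}$ for $x,y\in\mathbb{C}$, $x\neq y$. For a radius $\gamma>0$ and a positive integer $N$, the proxy points are $z_j=\gamma\exp\!\left(\frac{2j\pi\mathbf{i}}{N}\right)$, $j=1,\dots,N$ (with $\mathbf{i}=\sqrt{-1}$), and the proxy approximation of the kernel is $$\tilde\kappa(x,y)=\sum_{j=1}^{N}\kappa(x,z_j)\,\phi(z_j,y),\qquad \phi(z,y)=\frac{1}{N}\,\frac{z}{y-z}\quad(y\neq z).$$ *)

(* Defs.v *)
From mathcomp Require Import all_boot all_order all_algebra.
From mathcomp Require Import complex.
From mathcomp Require Import reals sequences trigo exp.

Set Implicit Arguments.
Unset Strict Implicit.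
Unset Printing Implicit Defensive.

Import Order.TTheory GRing.Theory Num.Theory.

Local Open Scope ring_scope.
Local Open Scope complex_scope.

(* The complex numbers are R[i] over a realType R. The norm `|z| takes its
   values in R[i] itself, and the order of R[i] only relates numbers with equal
   imaginary parts; restricted to the image of %:C it is the order of R. *)

Section Proxy.
Variable R : realType.
Implicit Types (x y z : R[i]) (gamma : R) (d N j : nat).

Definition cexp z : R[i] :=
  (expR (complex.Re z))%:C *
  (cos (complex.Im z) +i* sin (complex.Im z)).

(* Division is total in MathComp: the values at the excluded points (z = 1 for
   g, x = y for kappa, y = z for phi) are junk. *)
Definition g z : R[i] := 1 / (z - 1).

Definition kappa d x y : R[i] := 1 / (x - y) ^+ d.

Definition phi N z y : R[i] := 1 / N%:R * (z / (y - z)).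

Definition proxy_point gamma N j : R[i] :=
  gamma%:C * cexp (2 * j%:R * pi%:C * 'i / N%:R).

Definition kappa_proxy d gamma N x y : R[i] :=
  \sum_(1 <= j < N.+1)
    kappa d x (proxy_point gamma N j) * phi N (proxy_point gamma N j) y.

Definition rel_error d gamma N x y : R[i] :=
  (kappa_proxy d gamma N x y - kappa d x y) / kappa d x y.

Definition bound_coef d N x y : R[i] :=
  if d == 1%N then 1 else
  2 + 2 * \sum_(1 <= j < d)
    ((`|y / x| + 1) * N%:R) ^+ j * (2 * d%:R) ^+ j.-1 / j`!%:R.

End Proxy.

(* Main.v *)
(* Put s = x - y and rho = s / (x - z_j). Each node contributes
   s^d kappa(x, z_j) z_j / (y - z_j) = rho^d / (1 - rho) * z_j / (x - z_j) to
   1 + eps. Expanding rho^d / (1 - rho) = 1 / (1 - rho) - sum_(i < d) rho^i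
   writes eps as a sum of means over the nodes of u / (1 - u), with u = z_j / y,
   and of v^n / (1 - v)^k, with v = x / z_j. As u^N and v^N do not depend on j,
   1 / (1 - v) is a polynomial in v of degree N - 1 divided by 1 - v^N, and only
   exponents divisible by N survive in the mean. This bounds each mean by
   N^(k-1) q / (1 - q)^k with q = |x / gamma|^N, and (1 - q)^(1-k) <= 2 as soon
   as 2 d q <= 1. *)
Require Import Defs.
From mathcomp Require Import all_boot all_order all_algebra.
From mathcomp Require Import complex ring lra zify.
From mathcomp Require Import reals sequences trigo exp.

Import Order.TTheory GRing.Theory Num.Theory.

Local Open Scope ring_scope.
Local Open Scope complex_scope.

(** * Power sums and pole means over equidistributed nodes *)

(** Moving the window from [n] to [n.+1] drops [n] and gains [n + N], and [N] divides both or
    neither. *)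
Lemma sum_dvdn_shift (N n : nat) :
  (0 < N)%N -> (\sum_(i < N) (N %| n + i) = 1)%N.
Proof.
case: N => // N _; elim: n => [|n IHn].
  rewrite big_ord_recl addn0 dvdn0 big1 // => i _.
  by rewrite add0n lift0 gtnNdvd // ltnS ltn_ord.
rewrite -IHn big_ord_recr big_ord_recl /= addn0 addnC addSnnS.
rewrite -{1}[N.+1]mul1n dvdn_addl ?mul1n //.
by congr addn; apply: eq_bigr => i _; rewrite /bump add1n addSnnS.
Qed.

Section EquidistributedNodes.
Variables (C : numFieldType) (N : nat) (v : nat -> C) (Q : C).
Hypothesis N_gt0 : (0 < N)%N.
Hypothesis vN : forall j, v j ^+ N = Q.
Hypothesis v_sum : forall n, ~~ (N %| n)%N -> \sum_(1 <= j < N.+1) v j ^+ n = 0.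

(** When [N] divides [n], all summands equal the same positive power of [Q]. The indicator stays in
    the bound so that a window of [N] exponents counts only once. *)
Lemma norm_power_sum_le (n : nat) : `|Q| <= 1 -> (0 < n)%N ->
  `|\sum_(1 <= j < N.+1) v j ^+ n| <= (N %| n)%:R * (N%:R * `|Q|).
Proof.
move=> Q1 n_gt0; have [/dvdnP[m nE]|/v_sum->] := boolP (N %| n)%N; last first.
  by rewrite normr0 mul0r.
have m_gt0 : (0 < m)%N by move: n_gt0; rewrite nE muln_gt0 => /andP[].
rewrite mul1r (eq_bigr (fun=> Q ^+ m)) => [|j _]; last first.
  by rewrite nE mulnC exprM vN.
rewrite sumr_const_nat subn1 /= normrMn normrX mulr_natl.
by rewrite lerMn2r ler_iXnr ?normr_ge0 ?orbT.
Qed.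

(** Expanding one geometric factor runs the exponent through [N] consecutive values. With a single
    factor only one of them is a multiple of [N]; each further factor costs [N]. *)
Lemma norm_geom_sum_le (k n : nat) : `|Q| <= 1 -> (0 < n)%N ->
  `|\sum_(1 <= j < N.+1) v j ^+ n * (\sum_(i < N) v j ^+ i) ^+ k.+1|
    <= N%:R ^+ k.+1 * `|Q|.
Proof.
move=> Q1; elim: k n => [|k IHk] n n_gt0.
  under eq_bigr do rewrite expr1 mulr_sumr.
  rewrite exchange_big /=.
  apply: le_trans (ler_norm_sum _ _ _) _.
  have -> : N%:R ^+ 1 * `|Q| = \sum_(i < N) (N %| n + i)%:R * (N%:R * `|Q|).
    by rewrite -mulr_suml -natr_sum sum_dvdn_shift // mul1r.
  apply: ler_sum => i _; under eq_bigr do rewrite -exprD.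
  by apply: norm_power_sum_le => //; rewrite addn_gt0 n_gt0.
under eq_bigr do rewrite exprS mulrA mulr_sumr mulr_suml.
rewrite exchange_big /=.
apply: le_trans (ler_norm_sum _ _ _) _.
have -> : N%:R ^+ k.+2 * `|Q| = \sum_(i < N) N%:R ^+ k.+1 * `|Q|.
  by rewrite sumr_const card_ord exprS -mulrA mulr_natl.
apply: ler_sum => i _; under eq_bigr do rewrite -exprD.
by apply: IHk; rewrite addn_gt0 n_gt0.
Qed.

(* Since [v j ^+ N = Q], [1 / (1 - v j)] is the finite geometric sum of [v j]
   divided by [1 - Q], which avoids infinite series. *)
Lemma norm_mean_pole_le (k n : nat) : `|Q| < 1 -> (0 < n)%N ->
  `|N%:R^-1 * \sum_(1 <= j < N.+1) v j ^+ n / (1 - v j) ^+ k.+1|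
    <= N%:R ^+ k * `|Q| / (1 - `|Q|) ^+ k.+1.
Proof.
move=> Q1 n_gt0.
have Qd : 0 < 1 - `|Q| by rewrite subr_gt0.
have Qd' : 1 - `|Q| <= `|1 - Q| by rewrite -[1 in X in X <= _]normr1 lerB_dist.
have Q0 : 1 - Q != 0 by rewrite -normr_gt0; apply: lt_le_trans Qd'.
have vE j : (1 - v j)^-1 = (\sum_(i < N) v j ^+ i) / (1 - Q).
  have := subrX1 (v j) N; rewrite vN => QE.
  have vj0 : 1 - v j != 0.
    apply: contra_neq Q0 => v1; apply: oppr_inj; rewrite opprB QE -opprB v1.
    by rewrite oppr0 mul0r.
  apply: (mulfI vj0); rewrite mulfV // mulrA -[1 - v j]opprB mulNr -QE.
  by rewrite opprB mulfV.
under eq_bigr do rewrite -exprVn vE exprMn mulrA.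
rewrite -mulr_suml !normrM normfV normr_nat normrX normfV exprVn mulrA.
apply: ler_pM; rewrite ?mulr_ge0 ?invr_ge0 ?exprn_ge0 ?ler0n //.
  (* The [N^-1] of the mean cancels one of the [k.+1] factors [N]. *)
  by rewrite ler_pdivrMl ?ltr0n // mulrA -exprS norm_geom_sum_le // ltW.
by rewrite lef_pV2 ?posrE ?exprn_gt0 ?normr_gt0 // lerXn2r ?nnegrE ?normr_ge0 ?(ltW Qd).
Qed.

End EquidistributedNodes.

(** * Error estimate for abstract nodes and comparison with the constant *)

Lemma bernoulli_ge (C : numDomainType) (h : C) (n : nat) :
  -1 <= h -> 1 + n%:R * h <= (1 + h) ^+ n.
Proof.
move=> h1; have h0 : 0 <= 1 + h by rewrite addrC -[1]opprK subr_ge0.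
elim: n => [|n IHn]; first by rewrite mul0r addr0.
rewrite exprS; apply: le_trans (ler_wpM2l h0 IHn).
rewrite -subr_ge0.
have -> : (1 + h) * (1 + n%:R * h) - (1 + n.+1%:R * h) = n%:R * (h * h).
  by rewrite -natr1; ring.
(* [-1 <= h] forces [h] to be real, so its square is nonnegative even if the order of [C] is
   partial. *)
by rewrite mulr_ge0 // -expr2 real_exprn_even_ge0 // -(ler_real h1) rpredN rpred1.
Qed.

(* With [v = x / z] and [rho = (x - y) / (x - z)] one has [1 - v = - (x - z) / z]
   and [y - z = (x - z) (1 - rho)], so the sum is geometric in [rho]. *)
Lemma node_identity (C : fieldType) (e : nat) (x y z : C) :
    x != 0 -> y != 0 -> z != 0 -> x - z != 0 -> y - z != 0 ->
  (x - y) ^+ e.+1 * (1 / (x - z) ^+ e.+1 * (z / (y - z))) =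
  1 + (z / y) ^+ 1 / (1 - z / y) ^+ 1 + (x / z) ^+ 1 / (1 - x / z) ^+ 1
  + \sum_(j < e) (- ((x - y) / x)) ^+ j.+1
                  * ((x / z) ^+ j.+1 / (1 - x / z) ^+ j.+2).
Proof.
move=> x0 y0 z0 xz yz; have zx : z - x != 0 by rewrite -opprB oppr_eq0.
pose rho := (x - y) / (x - z).
have termE j : (- ((x - y) / x)) ^+ j.+1
    * ((x / z) ^+ j.+1 / (1 - x / z) ^+ j.+2) = - (z / (x - z)) * rho ^+ j.+1.
  rewrite [(1 - x / z) ^+ j.+2]exprSr invfM !mulrA -exprVn -!exprMn mulrC.
  by congr (_ * _ ^+ _); rewrite /rho; field; rewrite ?xz ?z0 ?zx ?x0.
under eq_bigr do rewrite termE.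
rewrite -mulr_sumr mul1r mulrA -exprVn -exprMn -/rho.
have := subrX1 rho e.+1; rewrite big_ord_recl expr0 => /eqP.
rewrite subr_eq => /eqP ->; rewrite !expr1.
set S := \sum_(i < e) _; rewrite /rho; field.
by rewrite ?xz ?z0 ?zx ?x0 ?y0 ?yz.
Qed.

(** The nodes enter only through their common [N]-th power and vanishing power sums: positive powers
    serve the means in [z j / y], inverse powers those in [x / z j]. *)
Lemma norm_rel_error_le (C : numFieldType) (N e : nat) (z : nat -> C)
    (G x y U q : C) :
    (0 < N)%N -> x != 0 -> x != y -> (forall j, z j ^+ N = G) ->
    (forall n, ~~ (N %| n)%N -> \sum_(1 <= j < N.+1) z j ^+ n = 0) ->
    (forall n, ~~ (N %| n)%N -> \sum_(1 <= j < N.+1) (z j)^-1 ^+ n = 0) ->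
    `|x| ^+ N < `|G| -> `|G| < `|y| ^+ N ->
  U = `|G| / `|y| ^+ N -> q = `|x| ^+ N / `|G| ->
  `|(\sum_(1 <= j < N.+1) 1 / (x - z j) ^+ e.+1 * (1 / N%:R * (z j / (y - z j)))
     - 1 / (x - y) ^+ e.+1) / (1 / (x - y) ^+ e.+1)|
  <= U / (1 - U) + q / (1 - q)
     + \sum_(j < e) (1 + `|y / x|) ^+ j.+1 * (N%:R ^+ j.+1 * q / (1 - q) ^+ j.+2).
Proof.
move=> N_gt0 x0 xy zN zs zVs xG Gy UE0 qE0.
have G_gt0 : 0 < `|G| by rewrite (le_lt_trans _ xG) ?exprn_ge0.
have y_gt0 : 0 < `|y| ^+ N by rewrite (lt_trans _ Gy).
have y0 : y != 0 by apply: contraTneq y_gt0 => ->; rewrite normr0 expr0n gtn_eqF ?ltxx.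
have z0 j : z j != 0.
  by apply: contraTneq G_gt0 => z0; rewrite -(zN j) z0 expr0n gtn_eqF ?normr0 ?ltxx.
have xz j : x - z j != 0.
  rewrite subr_eq0; apply: contraTneq xG => ->; by rewrite -normrX zN ltxx.
have yz j : y - z j != 0.
  rewrite subr_eq0; apply: contraTneq Gy => ->; by rewrite -normrX zN ltxx.
have N0 : N%:R != 0 :> C by rewrite pnatr_eq0 -lt0n.
have UE : `|G / y ^+ N| = U by rewrite UE0 normrM normfV normrX.
have qE : `|x ^+ N / G| = q by rewrite qE0 normrM normfV normrX.
have U1 : `|G / y ^+ N| < 1 by rewrite UE UE0 ltr_pdivrMr // mul1r.
have q1 : `|x ^+ N / G| < 1 by rewrite qE qE0 ltr_pdivrMr // mul1r.
have uN j : (z j / y) ^+ N = G / y ^+ N by rewrite exprMn exprVn zN.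
have us n : ~~ (N %| n)%N -> \sum_(1 <= j < N.+1) (z j / y) ^+ n = 0.
  by move=> Nn; under eq_bigr do rewrite exprMn; rewrite -mulr_suml zs // mul0r.
have vN j : (x / z j) ^+ N = x ^+ N / G by rewrite exprMn exprVn zN.
have vs n : ~~ (N %| n)%N -> \sum_(1 <= j < N.+1) (x / z j) ^+ n = 0.
  by move=> Nn; under eq_bigr do rewrite exprMn; rewrite -mulr_sumr zVs // mulr0.
have xy0 : (x - y) ^+ e.+1 != 0 by rewrite expf_eq0 subr_eq0 (negPf xy) andbF.
have -> : forall K, (K - 1 / (x - y) ^+ e.+1) / (1 / (x - y) ^+ e.+1)
    = (x - y) ^+ e.+1 * K - 1 by move=> K; field; rewrite -?exprS ?xy0.
rewrite mulr_sumr.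
pose T j : C := (x - y) ^+ e.+1 * (1 / (x - z j) ^+ e.+1 * (z j / (y - z j))).
rewrite (eq_bigr (fun j => N%:R^-1 * T j)) => [|j _]; last by rewrite /T; ring.
rewrite -mulr_sumr (eq_bigr _ (fun j _ =>
  @node_identity C e x y (z j) x0 y0 (z0 j) (xz j) (yz j))).
rewrite !big_split exchange_big /= sumr_const_nat subn1 /=.
(* The constant 1 of [node_identity] averages to 1 and cancels the [- 1]. *)
have -> : forall A B D : C, N%:R^-1 * (N%:R + A + B + D) - 1
    = N%:R^-1 * A + N%:R^-1 * B + N%:R^-1 * D by move=> A B D; field.
apply: le_trans (ler_normD _ _) (lerD _ _).
  apply: le_trans (ler_normD _ _) (lerD _ _).
    by have := @norm_mean_pole_le C N _ _ N_gt0 uN us 0 1 U1 isT; rewrite UE mul1r expr1.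
  by have := @norm_mean_pole_le C N _ _ N_gt0 vN vs 0 1 q1 isT; rewrite qE mul1r expr1.
rewrite mulr_sumr; apply: le_trans (ler_norm_sum _ _ _) _.
apply: ler_sum => j _; rewrite -mulr_sumr mulrCA normrM.
apply: ler_pM => //; last first.
  by have := @norm_mean_pole_le C N _ _ N_gt0 vN vs j.+1 j.+1 q1 isT; rewrite qE.
(* As [(x - y) / x = 1 - y / x], the triangle inequality yields the factor [1 + |y / x|]. *)
rewrite normrX lerXn2r ?nnegrE ?addr_ge0 //.
by rewrite normrN mulrBl mulfV // (le_trans (ler_normB _ _)) ?normr1.
Qed.

(* The means are bounded without the factor [1 / j!] of the paper's constant;
   its factor [(2 d)^(j-1)] makes up for it. *)
Lemma fact_le_exp (d j : nat) : (j < d)%N -> (j.+1`! <= (2 * d) ^ j)%N.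
Proof.
elim: j => [|j IHj] jd; first by [].
by rewrite factS expnS leq_mul ?IHj ?(ltnW jd) //; lia.
Qed.

(** Here [t] stands for [|y / x| + 1] and [e.+1] for [d]. One factor [1 - q] of each pole goes into
    [q / (1 - q)]; the others cost at most 2. *)
Lemma rel_error_bound_le (C : numFieldType) (N e : nat) (q t : C) :
    0 <= t -> 0 <= q -> 2 * e.+1%:R * q <= 1 ->
  q / (1 - q) + \sum_(j < e) t ^+ j.+1 * (N%:R ^+ j.+1 * q / (1 - q) ^+ j.+2) <=
  (if e.+1 == 1%N then 1 else
   2 + 2 * \sum_(1 <= j < e.+1) (t * N%:R) ^+ j * (2 * e.+1%:R) ^+ j.-1 / j`!%:R)
  * (q / (1 - q)).
Proof.
move=> t0 q0 qe.
(* Bernoulli gives [(1 - q)^k >= 1 - k q >= 1/2]. *)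
have inv2_le (k : nat) : (k <= e.+1)%N -> 1 <= 2 * (1 - q) ^+ k.
  move=> ke; have kq : 2 * (k%:R * q) <= 1.
    by apply: le_trans qe; rewrite -mulrA !ler_wpM2l ?ler_wpM2r ?ler_nat.
  have q_ge : -1 <= - q.
    rewrite lerN2; apply: le_trans qe; rewrite ler_peMl //.
    by rewrite -natrM ler1n muln_gt0.
  apply: le_trans (ler_wpM2l _ (@bernoulli_ge C (- q) k q_ge)) => //.
  by rewrite mulrN mulrBr mulr1 -natr1 -addrA lerDl subr_ge0.
have q1 : 0 < 1 - q.
  by rewrite -(@pmulr_rgt0 _ 2) // (lt_le_trans ltr01) // -[1 - q]expr1 inv2_le.
set p := q / (1 - q); have p0 : 0 <= p by rewrite divr_ge0 // ltW.
(* For [d = 1] the sum is empty and both sides agree. *)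
case: eqP => [[->]|_]; first by rewrite big_ord0 addr0 mul1r.
rewrite mulrDl; apply: lerD; first by rewrite -[leLHS]mul1r ler_wpM2r ?ler1n.
rewrite big_add1 big_mkord mulr_sumr mulr_suml.
apply: ler_sum => j _.
have -> : t ^+ j.+1 * (N%:R ^+ j.+1 * q / (1 - q) ^+ j.+2) =
    (t * N%:R) ^+ j.+1 * p * ((1 - q) ^+ j.+1)^-1.
  by rewrite exprMn [(1 - q) ^+ j.+2]exprS invfM /p !mulrA.
set W := (t * N%:R) ^+ j.+1.
have W0 : 0 <= W by rewrite exprn_ge0 ?mulr_ge0.
have -> : 2 * (W * (2 * e.+1%:R) ^+ j / (j.+1)`!%:R) * p =
   (W * p) * (2 * ((2 * e.+1%:R) ^+ j / (j.+1)`!%:R)) by ring.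
(* The 2 absorbs the inverse power of [1 - q]; the quotient of [(2 d)^j] by the factorial is at
   least 1. *)
rewrite ler_wpM2l ?(mulr_ge0 W0 p0) //; apply: (@le_trans _ _ 2).
  by rewrite -[leLHS]mul1r ler_pdivrMr ?exprn_gt0 ?inv2_le ?ltnS // ltnW.
rewrite ler_peMr // ler_pdivlMr ?ltr0n ?fact_gt0 // mul1r -natrM -natrX ler_nat.
by rewrite fact_le_exp // ltnW // ltnS.
Qed.

(** * Proxy points as scaled roots of unity *)

Section RootsOfUnity.
Variable R : realType.

Lemma cexpD (z w : R[i]) : cexp (z + w) = cexp z * cexp w.
Proof.
case: z w => [a b] [c e]; rewrite /cexp /= expRD cosD sinD.
by apply/eqP; rewrite eq_complex /=; apply/andP; split; apply/eqP; ring.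
Qed.

Lemma cexp0 : cexp (0 : R[i]) = 1.
Proof.
by rewrite /cexp /= expR0 cos0 sin0 mul1r.
Qed.

Lemma cexpMn (z : R[i]) (n : nat) : cexp (n%:R * z) = cexp z ^+ n.
Proof.
elim: n => [|n IHn]; first by rewrite mul0r cexp0.
by rewrite -natr1 mulrDl mul1r cexpD IHn exprSr.
Qed.

Lemma cexp_imag (t : R) : cexp (t%:C * 'i) = cos t +i* sin t.
Proof.
by rewrite /cexp /= !mul0r !mulr0 mulr1 addr0 subr0 expR0 mul1r.
Qed.

Definition root_angle (N : nat) : R[i] := (pi *+ 2 / N%:R)%:C * 'i.

Lemma cexp_root_exp (N n : nat) : cexp (root_angle N) ^+ n =
  cos (n%:R / N%:R * pi *+ 2) +i* sin (n%:R / N%:R * pi *+ 2).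
Proof.
rewrite -cexpMn -cexp_imag mulrA -(rmorph_nat (real_complex R)) -rmorphM.
by have -> : n%:R * (pi *+ 2 / N%:R) = n%:R / N%:R * pi *+ 2 :> R by ring.
Qed.

Lemma cexp_root_expN (N : nat) : (0 < N)%N -> cexp (root_angle N) ^+ N = 1.
Proof.
move=> N_gt0; rewrite cexp_root_exp divff ?pnatr_eq0 -?lt0n // mul1r cos2pi.
by rewrite sin_mulr2n sinpi mulr0 mul0rn.
Qed.

(** Half-angle argument: the real part is [cos 2t = 1 - 2 sin^2 t] with [t = n pi / N] strictly
    between 0 and [pi], where [sin t > 0]. *)
Lemma cexp_root_neq1 (N n : nat) :
  (0 < n < N)%N -> cexp (root_angle N) ^+ n != 1.
Proof.
move=> /andP[n_gt0 nN]; rewrite cexp_root_exp; apply/eqP => -[].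
set t := _ * pi; have t_gt0 : 0 < sin t.
  apply: sin_gt0_pi; rewrite /t mulr_gt0 ?pi_gt0 ?divr_gt0 ?ltr0n //=; last first.
    exact: leq_ltn_trans nN.
  rewrite gtr_pMl ?pi_gt0 // ltr_pdivrMr ?mul1r ?ltr_nat // ltr0n.
  exact: leq_ltn_trans nN.
have := cos2Dsin2 t; rewrite cos_mulr2n; nra.
Qed.

Lemma proxy_pointE (gamma : R) (N j : nat) :
  proxy_point gamma N j = gamma%:C * cexp (root_angle N) ^+ j.
Proof.
rewrite /proxy_point -cexpMn /root_angle rmorphM rmorphMn fmorphV !rmorph_nat /=.
by congr (_ * cexp _); ring.
Qed.

Lemma sum_powers_eq0 (F : fieldType) (N : nat) (a : F) :
  a ^+ N = 1 -> a != 1 -> \sum_(1 <= j < N.+1) a ^+ j = 0.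
Proof.
(* Multiplying by [a - 1] telescopes the sum to [a (a^N - 1) = 0]. *)
move=> aN a1; apply: (mulfI (_ : a - 1 != 0)); first by rewrite subr_eq0.
rewrite mulr0 big_add1 big_mkord; under eq_bigr do rewrite exprS.
by rewrite -mulr_sumr mulrCA -subrX1 aN subrr mulr0.
Qed.

Lemma proxy_point_expN (gamma : R) (N j : nat) :
  (0 < N)%N -> proxy_point gamma N j ^+ N = gamma%:C ^+ N.
Proof.
by move=> N_gt0; rewrite proxy_pointE exprMn exprAC cexp_root_expN // expr1n mulr1.
Qed.

Lemma cexp_root_exp_dvdn (N n : nat) : (0 < N)%N -> ~~ (N %| n)%N ->
  cexp (root_angle N) ^+ n != 1.
Proof.
move=> N_gt0 Nn; rewrite (divn_eq n N) exprD mulnC exprM cexp_root_expN //.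
by rewrite expr1n mul1r cexp_root_neq1 // lt0n Nn ltn_mod.
Qed.

Lemma sum_proxy_point_exp (gamma : R) (N n : nat) : (0 < N)%N ->
  ~~ (N %| n)%N -> \sum_(1 <= j < N.+1) proxy_point gamma N j ^+ n = 0.
Proof.
move=> N_gt0 Nn; under eq_bigr do rewrite proxy_pointE exprMn exprAC.
rewrite -mulr_sumr sum_powers_eq0 ?mulr0 ?cexp_root_exp_dvdn //.
by rewrite exprAC cexp_root_expN // expr1n.
Qed.

Lemma sum_proxy_point_expV (gamma : R) (N n : nat) : (0 < N)%N ->
  ~~ (N %| n)%N -> \sum_(1 <= j < N.+1) (proxy_point gamma N j)^-1 ^+ n = 0.
Proof.
move=> N_gt0 Nn.
under eq_bigr do rewrite proxy_pointE exprVn exprMn exprAC invfM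
  -[(_ ^+ n ^+ _)^-1]exprVn.
rewrite -mulr_sumr sum_powers_eq0 ?mulr0 ?invr_eq1 ?cexp_root_exp_dvdn //.
by rewrite exprVn exprAC cexp_root_expN // expr1n invr1.
Qed.

End RootsOfUnity.

(** * Choice of the threshold and conclusion *)

(** By Bernoulli, the powers of [r^-1 = 1 + h] grow at least like [N h], which passes [eps^-1] once
    [N] exceeds [eps^-1 / h]. *)
Lemma exists_geometric_le (R : archiRealFieldType) (r eps : R) :
  0 < r -> r < 1 -> 0 < eps ->
  exists N1 : nat, forall N : nat, (N1 < N)%N -> r ^+ N <= eps.
Proof.
move=> r0 r1 eps0; set h := r^-1 - 1.
have h0 : 0 < h by rewrite subr_gt0 invf_gt1.
exists (Num.bound (eps^-1 / h)) => N N1N.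
rewrite -[r]invrK -[eps]invrK exprVn lef_pV2 ?posrE ?exprn_gt0 ?invr_gt0 //.
have -> : r^-1 = 1 + h by rewrite /h addrC subrK.
apply: le_trans (@bernoulli_ge _ _ _ _); last by rewrite (le_trans _ (ltW h0)) ?lerN10.
apply: (@le_trans _ _ (N%:R * h)); last by rewrite lerDr.
rewrite -ler_pdivrMr //; apply: ltW; apply: lt_le_trans (archi_boundP _) _.
  by rewrite divr_ge0 ?invr_ge0 // ltW.
by rewrite ler_nat ltnW.
Qed.

(** The identity [1 / (w - 1) = w^-1 / (1 - w^-1)] brings [g] to the shape of the bounds on the
    means. *)
Lemma g_expr_div (R : realType) (a b : R[i]) (N : nat) :
    (0 < N)%N -> 0 < b -> b < a ->
  g ((a / b) ^+ N) = b ^+ N / a ^+ N / (1 - b ^+ N / a ^+ N).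
Proof.
move=> N_gt0 b_gt0 ba; have a_gt0 := lt_trans b_gt0 ba; rewrite expr_div_n.
have aN0 : a ^+ N != 0 by rewrite expf_neq0 ?gt_eqF.
have bN0 : b ^+ N != 0 by rewrite expf_neq0 ?gt_eqF.
have ab : a ^+ N != b ^+ N by rewrite gt_eqF // ltrXn2r -?lt0n // ltW.
by rewrite /g; field; rewrite aN0 bN0 subr_eq0 ab.
Qed.

Theorem theorem2p3 (R : realType) (d : nat) (x y : R[i]) (gamma1 gamma : R) :
  (0 < d)%N ->
  0 < gamma1 -> 0 < gamma ->
  0 < `|x| -> `|x| < gamma1%:C -> gamma1 < gamma -> gamma%:C < `|y| ->
  exists N1 : nat, (0 < N1)%N /\
    forall N : nat, (N1 < N)%N ->
      `|rel_error d gamma N x y|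
        <= g (`|y / gamma%:C| ^+ N)
           + bound_coef d N x y * g (`|gamma%:C / x| ^+ N).
Proof.
case: d => // e _ _ gamma_gt0 x_gt0 x_lt g1_lt y_gt.
have gC_gt0 : 0 < gamma%:C by rewrite ltcR.
have gE : `|gamma%:C| = gamma%:C by rewrite gtr0_norm.
have xg : `|x| < gamma%:C by apply: lt_trans x_lt _; rewrite ltcR.
have y_gt0 := lt_trans gC_gt0 y_gt.
have xE : (complex.Re `|x|)%:C = `|x| by rewrite RRe_real ?normr_real.
(* The ratio is taken in [R], which is archimedean and totally ordered, unlike [R[i]]. *)
pose r := complex.Re `|x| / gamma.
have rE : r%:C = `|x| / gamma%:C by rewrite /r rmorphM fmorphV /= xE.
have r_gt0 : 0 < r by rewrite -ltcR rE divr_gt0.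
have r_lt1 : r < 1 by rewrite -ltcR rE ltr_pdivrMr // mul1r.
have d2_gt0 : 0 < 2 * e.+1%:R :> R by rewrite -natrM ltr0n.
(* The tolerance [1 / (2 d)] is what turns [q = r^N] into [2 d q <= 1]. *)
have [N1 N1P] := @exists_geometric_le R r (2 * e.+1%:R)^-1 r_gt0 r_lt1
  (etrans (invr_gt0 _) d2_gt0).
(* The successor makes the witness positive, as [N1] may be 0. *)
exists N1.+1; split=> // N N1N.
have N_gt0 : (0 < N)%N by apply: leq_trans N1N.
have {N1P}rN := N1P N (ltnW N1N).
pose q := `|x| ^+ N / gamma%:C ^+ N; pose U := gamma%:C ^+ N / `|y| ^+ N.
have xN_lt : `|x| ^+ N < gamma%:C ^+ N.
  by rewrite ltrXn2r ?nnegrE -?lt0n // ?ltW // gt_eqF.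
have yN_gt : gamma%:C ^+ N < `|y| ^+ N by rewrite ltrXn2r ?nnegrE -?lt0n // ltW.
have qd : 2 * e.+1%:R * q <= 1.
  have -> : q = (r ^+ N)%:C by rewrite rmorphXn /= rE expr_div_n.
  rewrite -natrM -(rmorph_nat (real_complex R)) natrM -rmorphM
    -(rmorph1 (real_complex R)).
  by rewrite lecR mulrC -ler_pdivlMr // mul1r.
have gyE : g (`|y / gamma%:C| ^+ N) = U / (1 - U).
  by rewrite normf_div gE; apply: g_expr_div.
have gxE : g (`|gamma%:C / x| ^+ N) = q / (1 - q).
  by rewrite normf_div gE; apply: g_expr_div.
rewrite gyE gxE.
have zN j := @proxy_point_expN R gamma N j N_gt0.
have zs n := @sum_proxy_point_exp R gamma N n N_gt0.
have zVs n := @sum_proxy_point_expV R gamma N n N_gt0.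
have x0 : x != 0 by rewrite -normr_gt0.
have xy : x != y by apply: contraTneq (lt_trans xg y_gt) => ->; rewrite ltxx.
have normG : `|gamma%:C ^+ N| = gamma%:C ^+ N by rewrite normrX gE.
have xN_lt' : `|x| ^+ N < `|gamma%:C ^+ N| by rewrite normG.
have yN_gt' : `|gamma%:C ^+ N| < `|y| ^+ N by rewrite normG.
have UE : U = `|gamma%:C ^+ N| / `|y| ^+ N by rewrite normG.
have qE : q = `|x| ^+ N / `|gamma%:C ^+ N| by rewrite normG.
apply: le_trans (@norm_rel_error_le R[i] N e _ _ x y U q
  N_gt0 x0 xy zN zs zVs xN_lt' yN_gt' UE qE) _.
rewrite -addrA lerD2l /bound_coef [1 + `|y / x|]addrC.
apply: rel_error_bound_le => //; first by rewrite addr_ge0.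
by rewrite divr_ge0 ?exprn_ge0 // ltW.
Qed.
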